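(* Let $d\geq 3$ be an odd integer and put $\hat d:=d-1$. In $\mathbb{C}^d\otimes\mathbb{C}^d\otimes\mathbb{C}^d$ define $$\begin{aligned} \mathcal{S}_1&:=\{|0\rangle_A|i\rangle_B|j+1\rangle_C\pm|\hat d\rangle_A|i+1\rangle_B|j\rangle_C \;:\; 0\le i,j\le d-2\},\\ \mathcal{S}_2&:=\{|i+1\rangle_A|0\rangle_B|j\rangle_C\pm|i\rangle_A|\hat d\rangle_B|j+1\rangle_C \;:\; 0\le i,j\le d-2\},\\ \mathcal{S}_3&:=\{|i\rangle_A|j+1\rangle_B|0\rangle_C\pm|i+1\rangle_A|j\rangle_B|\hat d\rangle_C \;:\; 0\le i,j\le d-2\},\\ \mathcal{S}_4&:=\{|0\rangle_A|0\rangle_B|0\rangle_C\pm|\hat d\rangle_A|\hat d\rangle_B|\hat d\rangle_C\}. \end{aligned}$$ Then $\mathcal{S}:=\bigcup_{i=1}^4\mathcal{S}_i$ is an orthogonal genuinely entangled set (OGES) of the strongest nonlocality, and it has exactly $d^3-(d-2)^3$ elements.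
   Context: The three tensor factors belong to parties $A,B,C$; the computational basis of $\mathbb{C}^d$ is $\{|0\rangle,\dots,|d-1\rangle\}$, and $|i\rangle_A|j\rangle_B|k\rangle_C=|i\rangle\otimes|j\rangle\otimes|k\rangle$. States are nonzero vectors and normalization factors are ignored. In the sets above each choice of $\pm$ gives a separate element, and $i+1$, $j+1$ are ordinary integer sums (with values in $\{1,\dots,d-1\}$). A pure tripartite state is genuinely entangled if for each of the bipartitions $A|BC$, $B|CA$, $C|AB$ it is not a tensor product of a vector of one side with a vector of the other side. An orthogonal genuinely entangled set (OGES) is a set of mutually orthogonal genuinely entangled states. Strongest nonlocality: a POVM on a Hilbert space is a finite family of positive semidefinite operators summing to the identity; it is trivial if every element is a scalar multiple of the identity. For a bipartition $X|Y$ of $\{A,B,C\}$, a POVM performed on one side, say $Y$, is orthogonality preserving for $\mathcal{S}$ if each of its elements $E$ satisfies $\langle\phi|\,\mathbb{I}_X\otimes E\,|\psi\rangle=0$ for all distinct $|\phi\rangle,|\psi\rangle\in\mathcal{S}$. An orthogonal set $\mathcal{S}$ is of the strongest nonlocality if for each bipartition ($A|BC$, $B|CA$, $C|AB$), every orthogonality-preserving POVM performed by either side of the bipartition is trivial (the two-party sides measuring jointly). *)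

(* Defs.v *)
From HB Require Import structures.
From mathcomp Require Import all_boot all_order all_algebra.
From mathcomp Require Import sesquilinear spectral.
From mathcomp Require Import mxtens complex.
From mathcomp Require Import boolp classical_sets cardinality reals.

Set Implicit Arguments.
Unset Strict Implicit.
Unset Printing Implicit Defensive.

Import Order.TTheory GRing.Theory Num.Theory.

Local Open Scope ring_scope.
Local Open Scope sesquilinear_scope.
Local Open Scope classical_set_scope.

Section Hilbert.
Variable C : numClosedFieldType.

Definition braket n (phi psi : 'cV[C]_n) : C := (phi ^t* *m psi) 0 0.

Definition psdmx n (E : 'M[C]_n) : Prop :=
  E ^t* = E /\ forall v : 'cV[C]_n, 0 <= braket v (E *m v).

Definition is_povm n m (E : 'I_m -> 'M[C]_n) : Prop :=
  (forall k, psdmx (E k)) /\ \sum_k E k = 1%:M.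

Definition trivial_povm n m (E : 'I_m -> 'M[C]_n) : Prop :=
  forall k, is_scalar_mx (E k).

Definition orthogonal_set n (S : set 'cV[C]_n) : Prop :=
  forall phi psi, S phi -> S psi -> phi <> psi -> braket phi psi = 0.

(* For S in the tensor product of an m-dimensional side X and an
   n-dimensional side Y. *)
Definition orthopres_left m n (S : set 'cV[C]_(m * n)) k
    (E : 'I_k -> 'M[C]_m) : Prop :=
  forall l phi psi, S phi -> S psi -> phi <> psi ->
    braket phi ((E l *t (1%:M : 'M[C]_n)) *m psi) = 0.

Definition orthopres_right m n (S : set 'cV[C]_(m * n)) k
    (E : 'I_k -> 'M[C]_n) : Prop :=
  forall l phi psi, S phi -> S psi -> phi <> psi ->
    braket phi (((1%:M : 'M[C]_m) *t E l) *m psi) = 0.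

Definition only_trivial_povms m n (S : set 'cV[C]_(m * n)) : Prop :=
  (forall k (E : 'I_k -> 'M[C]_m),
     is_povm E -> orthopres_left S E -> trivial_povm E) /\
  (forall k (E : 'I_k -> 'M[C]_n),
     is_povm E -> orthopres_right S E -> trivial_povm E).

Definition product_vector m n (psi : 'cV[C]_(m * n)) : Prop :=
  exists (u : 'cV[C]_m) (v : 'cV[C]_n), psi = u *t v.

End Hilbert.

Section Tripartite.
Variables (C : numClosedFieldType) (d : nat).

Definition tri : Type := 'cV[C]_(d * (d * d)).

(* The reordering A (x) B (x) C -> B (x) C (x) A of the tensor factors, i.e.
   the linear map with cyc (a *t (b *t c)) = b *t (c *t a). Iterating it turns
   the cuts B|CA and C|AB into the cut 1|23. *)
Definition cyc (psi : tri) : tri :=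
  \col_k let: (b, ca) := mxtens_unindex k in
         let: (c, a) := mxtens_unindex ca in
         psi (mxtens_index (a, mxtens_index (b, c))) 0.

Lemma cyc_tens (a b c : 'cV[C]_d) : cyc (a *t (b *t c)) = b *t (c *t a).
Proof.
apply/matrixP => k o; case: (mxtens_indexP k) => i k'.
case: (mxtens_indexP k') => j l; rewrite !mxE !mxtens_indexK /=.
rewrite !mxE !mxtens_indexK /= ?ord1.
by rewrite mulrC mulrA.
Qed.

Definition genuinely_entangled (psi : tri) : Prop :=
  [/\ psi <> 0,
      ~ @product_vector C d (d * d) psi,
      ~ @product_vector C d (d * d) (cyc psi) &
      ~ @product_vector C d (d * d) (cyc (cyc psi))].

Definition OGES (S : set tri) : Prop :=
  orthogonal_set S /\ forall psi, S psi -> genuinely_entangled psi.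

Definition strongest_nonlocality (S : set tri) : Prop :=
  [/\ orthogonal_set S,
      @only_trivial_povms C d (d * d) S,
      @only_trivial_povms C d (d * d) (cyc @` S) &
      @only_trivial_povms C d (d * d) ((cyc \o cyc) @` S)].

(* The basis vector |k>, for k < d (and 0 otherwise). *)
Definition ket (k : nat) : 'cV[C]_d := \col_(r < d) (r == k :> nat)%:R.

Definition ket3 (i j k : nat) : tri := ket i *t (ket j *t ket k).

Definition S1 : set tri :=
  [set psi | exists i j : nat, [/\ (i <= d - 2)%N, (j <= d - 2)%N &
     psi = ket3 0 i j.+1 + ket3 d.-1 i.+1 j \/
     psi = ket3 0 i j.+1 - ket3 d.-1 i.+1 j]].

Definition S2 : set tri :=
  [set psi | exists i j : nat, [/\ (i <= d - 2)%N, (j <= d - 2)%N &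
     psi = ket3 i.+1 0 j + ket3 i d.-1 j.+1 \/
     psi = ket3 i.+1 0 j - ket3 i d.-1 j.+1]].

Definition S3 : set tri :=
  [set psi | exists i j : nat, [/\ (i <= d - 2)%N, (j <= d - 2)%N &
     psi = ket3 i j.+1 0 + ket3 i.+1 j d.-1 \/
     psi = ket3 i j.+1 0 - ket3 i.+1 j d.-1]].

Definition S4 : set tri :=
  [set psi | psi = ket3 0 0 0 + ket3 d.-1 d.-1 d.-1 \/
             psi = ket3 0 0 0 - ket3 d.-1 d.-1 d.-1].

Definition Sall : set tri := S1 `|` S2 `|` S3 `|` S4.

End Tripartite.

Arguments Sall C d : clear implicits.

(* Main.v *)
(* The states are e_p + e_q and e_p - e_q for the edges {p, q} of a perfect
   matching of the boundary points of the cube {0, ..., d-1}^3, and matched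
   points differ in all three coordinates; hence genuine entanglement, and the
   count of states is the count of boundary points. The matching is invariant
   under cyclic shifts of the factors, so only the cut A|BC has to be treated.
   For M = E (x) 1 or M = 1 (x) E, the sign choices in the orthogonality
   conditions give M_pq = 0 between different edges and M_pp = M_qq on an edge,
   while M_pq = 0 on an edge by locality. As {0} x {0, ..., d-1}^2 and
   {0, ..., d-1} x {(0, 0)} lie in the boundary, E is diagonal, and the edges
   connect all its diagonal entries. *)
Require Import Defs.
From mathcomp Require Import all_boot all_order all_algebra.
From mathcomp Require Import mxtens zify ring.
From mathcomp Require Import complex classical_sets cardinality reals.

Set Implicit Arguments.
Unset Strict Implicit.
Unset Printing Implicit Defensive.

Import Order.TTheory GRing.Theory Num.Theory.

Local Open Scope ring_scope.
Local Open Scope classical_set_scope.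
Local Open Scope card_scope.
Local Open Scope sesquilinear_scope.

(** The bijection is the position in [enum B]. *)
Lemma card_set_finset (T : finType) (B : {set T}) : [set` B] #= `I_#|B|.
Proof.
rewrite -(_ : (index^~ (enum B)) @` [set` B] = `I_#|B|).
  rewrite card_eq_sym; apply: inj_card_eq => x y.
  rewrite !inE /= -!(mem_enum B) => xB yB exy.
  by rewrite -(nth_index x xB) exy nth_index.
apply/seteqP; split=> [_ [x xB <-]|k /= kB].
  by rewrite /= cardE index_mem mem_enum.
(* The bound on [k] excludes the empty enumeration, so its head [x0] can serve as the default of
   [nth]. *)
rewrite cardE in kB; case: (enum B) (enum_uniq B) (mem_enum B) kB => // x0 s us mB kB.
exists (nth x0 (x0 :: s) k); last by rewrite index_uniq.
by rewrite /= -mB mem_nth.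
Qed.

(** * The sesquilinear form in coordinates *)

Section Sesquilinear.
Variable C : numClosedFieldType.

Lemma braketDl n (u v w : 'cV[C]_n) : braket (u + v) w = braket u w + braket v w.
Proof. by rewrite /braket !linearD /= map_mxD mulmxDl mxE. Qed.

Lemma braketDr n (u v w : 'cV[C]_n) : braket u (v + w) = braket u v + braket u w.
Proof. by rewrite /braket mulmxDr mxE. Qed.

Lemma braketZl n (a : C) (u v : 'cV[C]_n) : braket (a *: u) v = a^* * braket u v.
Proof. by rewrite /braket linearZ /= map_mxZ -scalemxAl mxE. Qed.

Lemma braketZr n (a : C) (u v : 'cV[C]_n) : braket u (a *: v) = a * braket u v.
Proof. by rewrite /braket -scalemxAr mxE. Qed.

Lemma braket_delta n (M : 'M[C]_n) i j :
  braket (delta_mx i 0) (M *m delta_mx j 0) = M i j.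
Proof. by rewrite /braket trmx_delta map_delta_mx -rowE -colE !mxE. Qed.

Lemma tens_colE m n (u : 'cV[C]_m) (v : 'cV[C]_n) i j :
  (u *t v : 'cV_(m * n)) (mxtens_index (i, j)) 0 = u i 0 * v j 0.
Proof.
rewrite -[RHS](tensmxE u v i j 0 0).
by rewrite [mxtens_index (0, 0)]ord1.
Qed.

End Sesquilinear.

(** * The perfect matching of the boundary of the cube *)

Section Cube.
Variable d : nat.

Definition point : Type := 'I_d * ('I_d * 'I_d).

Definition rot (p : point) : point := (p.2.1, (p.2.2, p.1)).

Lemma rotK (p : point) : rot (rot (rot p)) = p.
Proof. by case: p => a [b c]. Qed.

(** This is the pairing in [S1]; its conjugates under [rot] give [S2] and [S3], and [corner] gives
    [S4]. Pairs are oriented: [q] is the ket that carries the sign. *)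
Definition facet (p q : point) : bool :=
  [&& p.1 == 0%N :> nat, q.1 == d.-1 :> nat, q.2.1 == p.2.1.+1 :> nat
    & p.2.2 == q.2.2.+1 :> nat].

Definition corner (p q : point) : bool :=
  [&& p.1 == 0%N :> nat, p.2.1 == 0%N :> nat & p.2.2 == 0%N :> nat] &&
  [&& q.1 == d.-1 :> nat, q.2.1 == d.-1 :> nat & q.2.2 == d.-1 :> nat].

Definition edge (p q : point) : bool :=
  [|| facet p q, facet (rot p) (rot q), facet (rot (rot p)) (rot (rot q))
    | corner p q].

Lemma edge_rot p q : edge (rot p) (rot q) = edge p q.
Proof.
case: p q => [a [b c]] [a' [b' c']]; rewrite /edge /rot /corner /=.
by apply/idP/idP; lia.
Qed.

Lemma point_eqP (p q : point) :
  (p = q) <-> [/\ p.1 = q.1 :> nat, p.2.1 = q.2.1 :> nat & p.2.2 = q.2.2 :> nat].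
Proof.
case: p q => [a [b c]] [a' [b' c']] /=; split=> [[-> -> ->]//|].
by case=> /val_inj -> /val_inj -> /val_inj ->.
Qed.

Hypothesis d_gt1 : (1 < d)%N.

Lemma edge_neq p q : edge p q ->
  [/\ p.1 != q.1, p.2.1 != q.2.1 & p.2.2 != q.2.2].
Proof.
case: p q => [a [b c]] [a' [b' c']]; rewrite /edge /facet /rot /corner /=.
by move=> H; split; apply/eqP => /(congr1 val) /= e; lia.
Qed.

Lemma edge_inj_r p q q' : edge p q -> edge p q' -> q = q'.
Proof.
case: p q q' => [a [b c]] [[a' ha] [[b' hb] [c' hc]]] [[a'' ?] [[b'' ?] [c'' ?]]].
by rewrite /edge /facet /rot /corner /= => H H'; apply/point_eqP => /=; split; lia.
Qed.

Lemma edge_inj_l p p' q : edge p q -> edge p' q -> p = p'.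
Proof.
case: p p' q => [[a' ha] [[b' hb] [c' hc]]] [[a'' ?] [[b'' ?] [c'' ?]]] [a [b c]].
by rewrite /edge /facet /rot /corner /= => H H'; apply/point_eqP => /=; split; lia.
Qed.

(** Together with [edge_inj_r] and [edge_inj_l], this makes distinct edges disjoint and fixes the
    role of each endpoint. *)
Lemma edge_oriented p q r : edge p q -> ~~ edge q r.
Proof.
case: p q r => [[a' ha] [[b' hb] [c' hc]]] [[a'' ?] [[b'' ?] [c'' ?]]]
  [[a ?] [[b ?] [c ?]]].
by rewrite /edge /facet /rot /corner /= => H; apply/negP => H'; lia.
Qed.

Definition interior_coords : {set 'I_d} := [set i : 'I_d | 0 < i < d.-1]%N%SET.

Definition boundary : {set point} :=
  (~: finset.setX interior_coords (finset.setX interior_coords interior_coords))%SET.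

Lemma card_interior_coords : #|interior_coords| = (d - 2)%N.
Proof.
have h0 : (0 < d)%N by lia.
have h1 : (d.-1 < d)%N by lia.
rewrite (_ : interior_coords = ~: [set Ordinal h0; Ordinal h1])%SET; last first.
  by apply/setP => i; rewrite !inE -!val_eqE /=; case: i => /= i hi; lia.
rewrite cardsCs finset.setCK cards2 card_ord -val_eqE /=.
by rewrite (_ : 0%N != d.-1) //; lia.
Qed.

Lemma card_boundary : #|boundary| = (d ^ 3 - (d - 2) ^ 3)%N.
Proof.
rewrite cardsCs finset.setCK !cardsX card_interior_coords !card_prod !card_ord.
by rewrite !expnS !expn0 !muln1.
Qed.

Lemma edge_boundary p q : edge p q -> p \in boundary /\ q \in boundary.
Proof.
case: p q => [[a' ha] [[b' hb] [c' hc]]] [[a'' ?] [[b'' ?] [c'' ?]]].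
by rewrite !inE /edge /facet /rot /corner /= => H; split; lia.
Qed.

Definition matched p := exists q, edge p q \/ edge q p.

Lemma matched_rot (p : point) : matched (rot p) -> matched p.
Proof.
(* As [rot] has order three, [rot (rot q)] is the preimage of [q]. *)
move=> [q e]; exists (rot (rot q)).
by rewrite -edge_rot -(edge_rot _ p) rotK.
Qed.

(** The two inequalities ensure that the coordinates [b + 1] and [c - 1] of the partner in [S1] stay
    in range. *)
Lemma matched_low (p : point) : p.1 = 0%N :> nat -> p.2.1 != d.-1 :> nat ->
  p.2.2 != 0%N :> nat -> matched p.
Proof.
case: p => [a [[b hb] [c hc]]] /= a0 b1 c0.
have h1 : (d.-1 < d)%N by lia.
have h2 : (b.+1 < d)%N by lia.
have h3 : (c.-1 < d)%N by lia.
exists (Ordinal h1, (Ordinal h2, Ordinal h3)); left.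
by rewrite /edge /facet /= a0 !eqxx prednK ?eqxx // lt0n.
Qed.

Lemma matched_high (p : point) : p.1 = d.-1 :> nat -> p.2.1 != 0%N :> nat ->
  p.2.2 != d.-1 :> nat -> matched p.
Proof.
case: p => [a [[b hb] [c hc]]] /= a0 b1 c0.
have h1 : (0 < d)%N by lia.
have h2 : (b.-1 < d)%N by lia.
have h3 : (c.+1 < d)%N by lia.
exists (Ordinal h1, (Ordinal h2, Ordinal h3)); right.
by rewrite /edge /facet /= a0 !eqxx prednK ?eqxx // lt0n.
Qed.

Lemma matched_corner (p : point) : p.1 = p.2.1 :> nat -> p.2.1 = p.2.2 :> nat ->
  (p.1 == 0%N :> nat) || (p.1 == d.-1 :> nat) -> matched p.
Proof.
case: p => [a [b c]] /= ab bc.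
have h0 : (0 < d)%N by lia.
have h1 : (d.-1 < d)%N by lia.
case/orP => /eqP a0.
  exists (Ordinal h1, (Ordinal h1, Ordinal h1)); left.
  by rewrite /edge /corner /= -bc -ab a0 !eqxx !orbT.
exists (Ordinal h0, (Ordinal h0, Ordinal h0)); right.
by rewrite /edge /corner /= -bc -ab a0 !eqxx !orbT.
Qed.

Lemma boundary_matched p : p \in boundary -> matched p.
Proof.
(* By rotation, the faces where the first coordinate is 0 or [d - 1] suffice. The pairing of [S1]
   misses only lines of such a face on which a second coordinate is extreme. There a rotated pairing
   applies, except at the two corners joined by [corner]. *)
have base (r : point) : (r.1 == 0%N :> nat) || (r.1 == d.-1 :> nat) -> matched r.
  move=> H.
  have [a0|a0] := eqVneq (r.1 : nat) 0%N.
    have [c0|c0] := eqVneq (r.2.2 : nat) 0%N; last first.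
      have [b1|b1] := eqVneq (r.2.1 : nat) d.-1; last exact: matched_low.
      by apply/matched_rot/matched_high => /=; lia.
    have [b0|b0] := eqVneq (r.2.1 : nat) 0%N; first by apply: matched_corner; lia.
    by apply/matched_rot/matched_rot/matched_low => /=; lia.
  have a1 : r.1 = d.-1 :> nat by lia.
  have [c1|c1] := eqVneq (r.2.2 : nat) d.-1; last first.
    have [b0|b0] := eqVneq (r.2.1 : nat) 0%N; last exact: matched_high.
    by apply/matched_rot/matched_low => /=; lia.
  have [b1|b1] := eqVneq (r.2.1 : nat) d.-1; first by apply: matched_corner; lia.
  by apply/matched_rot/matched_rot/matched_high => /=; lia.
case: p => [[a ha] [[b hb] [c hc]]] pB.
have [|H] := boolP ((a == 0%N) || (a == d.-1)); first exact: (base (Ordinal ha, _)).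
have [H'|H'] := boolP ((b == 0%N) || (b == d.-1)).
  exact/matched_rot/base.
by apply/matched_rot/matched_rot/base; rewrite !inE /= in pB *; lia.
Qed.

End Cube.

(** * States as signed edges *)

Section States.
Variables (C : numClosedFieldType) (d : nat).
Hypothesis d_gt1 : (1 < d)%N.

Implicit Types (p q : point d) (b : bool).

Definition point_index p : 'I_(d * (d * d)) :=
  mxtens_index (p.1, mxtens_index (p.2.1, p.2.2)).

Lemma point_index_inj : injective point_index.
Proof.
move=> [a [b c]] [a' [b' c']] /(can_inj (@mxtens_indexK _ _)) /= [-> e].
by have /(can_inj (@mxtens_indexK _ _)) [-> ->] : mxtens_index (b, c) = mxtens_index (b', c')
  by apply: val_inj.
Qed.

Definition basis p : tri C d := delta_mx (point_index p) 0.

Lemma basisE p q : basis p (point_index q) 0 = (p == q)%:R.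
Proof. by rewrite mxE eqxx andbT (inj_eq point_index_inj) eq_sym. Qed.

Lemma ket3_basis (i j k : nat) (hi : (i < d)%N) (hj : (j < d)%N) (hk : (k < d)%N) :
  ket3 C d i j k = basis (Ordinal hi, (Ordinal hj, Ordinal hk)).
Proof.
apply/matrixP => r o; case: (mxtens_indexP r) => a bc.
case: (mxtens_indexP bc) => b c; rewrite !ord1.
rewrite -[mxtens_index _]/(point_index (a, (b, c))) basisE.
rewrite !tens_colE !mxE -!natrM !mulnb.
by rewrite !xpair_eqE -!val_eqE /= !(eq_sym (val _)).
Qed.

Lemma basis_ket3 p : basis p = ket3 C d p.1 p.2.1 p.2.2.
Proof. by case: p => [[a ha] [[b hb] [c hc]]]; rewrite -ket3_basis. Qed.

Lemma cyc_basis p : cyc (basis p) = basis (rot p).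
Proof.
by rewrite !basis_ket3 cyc_tens.
Qed.

Definition state b p q : tri C d := basis p + (-1) ^+ b *: basis q.

Lemma cyc_state b p q : cyc (state b p q) = state b (rot p) (rot q).
Proof.
rewrite /state -!cyc_basis; apply/matrixP => k o.
rewrite /cyc !mxE; case: (mxtens_unindex k) => x ca.
by case: (mxtens_unindex ca) => y z; rewrite !mxE.
Qed.

Lemma stateE b p q r :
  state b p q (point_index r) 0 = (p == r)%:R + (-1) ^+ b * (q == r)%:R.
Proof. by rewrite mxE basisE mxE basisE. Qed.

Lemma edge_neqE p q : edge p q -> p != q.
Proof. by move=> /(edge_neq d_gt1) [+ _ _]; apply: contraNneq => ->. Qed.

(** The coefficient 1 at [p] must come from [p'], because [q' = p] would violate the orientation.
    The matching then gives [q = q'], and the coefficient at [q] reveals the sign. *)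
Lemma state_inj b b' p q p' q' : edge p q -> edge p' q' ->
  state b p q = state b' p' q' -> [/\ b = b', p = p' & q = q'].
Proof.
move=> epq epq' /matrixP e.
have ep := e (point_index p) 0; have eq := e (point_index q) 0.
rewrite !stateE !eqxx in ep eq.
have npq := edge_neqE epq.
have nq'p : q' != p.
  by apply: contraTneq epq => <-; apply: edge_oriented epq'.
rewrite (negbTE npq) eq_sym (negbTE npq) (negbTE nq'p) !mulr0 !addr0 in ep eq.
have pp' : p = p'.
  by apply/eqP; rewrite eq_sym; case: (p' == p) ep => // /eqP; rewrite oner_eq0.
subst p'; have qq' := edge_inj_r d_gt1 epq epq'; subst q'; split=> //.
move: eq; rewrite eqxx (negbTE npq) !add0r !mulr1.
have ne : (1 : C) != -1 by rewrite -subr_eq0 opprK -(natrD _ 1 1) pnatr_eq0.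
case: b b' {e ep} => [] [] //=; rewrite expr0 expr1 => e; move: ne.
  by rewrite e eqxx.
by rewrite -e eqxx.
Qed.

Lemma addsubP (psi u v : tri C d) :
  (psi = u + v \/ psi = u - v) <-> exists b : bool, psi = u + (-1) ^+ b *: v.
Proof.
split=> [[->|->]|[[] ->]].
- by exists false; rewrite expr0 scale1r.
- by exists true; rewrite expr1 scaleN1r.
- by right; rewrite expr1 scaleN1r.
- by left; rewrite expr0 scale1r.
Qed.

(** This passes from kets with natural-number labels to edges of the cube; later arguments use only
    the edges. *)
Lemma SallP (psi : tri C d) :
  Sall C d psi <-> exists b p q, edge p q /\ psi = state b p q.
Proof.
have h0 : (0 < d)%N by lia.
have h1 : (d.-1 < d)%N by lia.
split; last first.
  move=> [b [p [q [+ ->]]]]; rewrite /state !basis_ket3.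
  have := ltn_ord p.1; have := ltn_ord p.2.1; have := ltn_ord p.2.2.
  have := ltn_ord q.1; have := ltn_ord q.2.1; have := ltn_ord q.2.2.
  move=> ? ? ? ? ? ?; rewrite /edge /facet /corner /= => /or4P [].
  - case/and4P => /eqP e1 /eqP e2 /eqP e3 /eqP e4; left; left; left.
    exists (p.2.1 : nat), (q.2.2 : nat); split; [lia|lia|].
    by apply/addsubP; exists b; rewrite e1 e2 e3 e4.
  - case/and4P => /eqP e1 /eqP e2 /eqP e3 /eqP e4; left; left; right.
    exists (q.1 : nat), (p.2.2 : nat); split; [lia|lia|].
    by apply/addsubP; exists b; rewrite e1 e2 e3 e4.
  - case/and4P => /eqP e1 /eqP e2 /eqP e3 /eqP e4; left; right.
    exists (p.1 : nat), (q.2.1 : nat); split; [lia|lia|].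
    by apply/addsubP; exists b; rewrite e1 e2 e3 e4.
  - case/andP => /and3P [/eqP e1 /eqP e2 /eqP e3] /and3P [/eqP e4 /eqP e5 /eqP e6]; right.
    by apply/addsubP; exists b; rewrite e1 e2 e3 e4 e5 e6.
(* Common to the four families: labels in range become points, and only the edge relation remains to
   be checked. *)
have mk i j k i' j' k' : psi = ket3 C d i j k + ket3 C d i' j' k' \/
      psi = ket3 C d i j k - ket3 C d i' j' k' ->
    [/\ i < d, j < d & k < d]%N -> [/\ i' < d, j' < d & k' < d]%N ->
    (forall p q : point d, p.1 = i :> nat -> p.2.1 = j :> nat -> p.2.2 = k :> nat ->
       q.1 = i' :> nat -> q.2.1 = j' :> nat -> q.2.2 = k' :> nat -> edge p q) ->
    exists b p q, edge p q /\ psi = state b p q.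
  move=> /addsubP [b ->] [hi hj hk] [hi' hj' hk'] e.
  exists b, (Ordinal hi, (Ordinal hj, Ordinal hk)).
  exists (Ordinal hi', (Ordinal hj', Ordinal hk')).
  by split; [exact: e | rewrite /state -!ket3_basis].
move=> [[[|]|]|].
- move=> [i [j [hi hj /mk]]]; apply; [by split; lia|by split; lia|].
  by move=> p q ? ? ? ? ? ?; apply/or4P/Or41/and4P; split; apply/eqP => /=; lia.
- move=> [i [j [hi hj /mk]]]; apply; [by split; lia|by split; lia|].
  by move=> p q ? ? ? ? ? ?; apply/or4P/Or42/and4P; split; apply/eqP => /=; lia.
- move=> [i [j [hi hj /mk]]]; apply; [by split; lia|by split; lia|].
  by move=> p q ? ? ? ? ? ?; apply/or4P/Or43/and4P; split; apply/eqP => /=; lia.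
- move=> /mk; apply; [by split; lia|by split; lia|].
  by move=> p q ? ? ? ? ? ?; apply/or4P/Or44/andP; split; apply/and3P; split; apply/eqP => /=; lia.
Qed.

Lemma Sall_state b p q : edge p q -> Sall C d (state b p q).
Proof. by move=> e; apply/SallP; exists b, p, q. Qed.

Lemma cyc_Sall (psi : tri C d) : Sall C d psi -> Sall C d (cyc psi).
Proof.
move=> /SallP [b [p [q [e ->]]]]; rewrite cyc_state.
by apply: Sall_state; rewrite edge_rot.
Qed.

Lemma image_cyc_Sall : @cyc C d @` Sall C d = Sall C d.
Proof.
apply/seteqP; split=> [_ [psi S <-]|psi /SallP [b [p [q [e ->]]]]].
  exact: cyc_Sall.
exists (state b (rot (rot p)) (rot (rot q))); last by rewrite cyc_state !rotK.
by apply: Sall_state; rewrite !edge_rot.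
Qed.

Lemma braket_state (M : 'M[C]_(d * (d * d))) b b' p q p' q' :
  braket (state b p q) (M *m state b' p' q') =
  M (point_index p) (point_index p') + (-1) ^+ b' * M (point_index p) (point_index q')
  + (-1) ^+ b * (M (point_index q) (point_index p')
                 + (-1) ^+ b' * M (point_index q) (point_index q')).
Proof.
rewrite /state mulmxDr -scalemxAr braketDl !braketDr !braketZl !braketZr.
by rewrite !braket_delta rmorph_sign; ring.
Qed.

(** * Orthogonality and genuine entanglement *)

Lemma Sall_orthogonal : orthogonal_set (Sall C d).
Proof.
move=> _ _ /SallP [b [p [q [e ->]]]] /SallP [b' [p' [q' [e' ->]]]] ne.
rewrite -[state b' p' q']mul1mx braket_state !mxE !(inj_eq point_index_inj).
have /negbTE -> : p != q'.
  by apply: contraTneq e => ->; apply: edge_oriented e'.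
have /negbTE -> : q != p'.
  by apply: contraTneq e' => <-; apply: edge_oriented e.
have [pp'|npp'] := eqVneq p p'.
  subst p'; have qq' := edge_inj_r d_gt1 e e'; subst q'; rewrite eqxx.
  case: b b' ne => [] [] ne; rewrite ?expr0 ?expr1 ?mulr0n ?mulr1n; [by case: ne| | |by case: ne].
    by ring.
  by ring.
have [qq'|_] := eqVneq q q'; last by rewrite !mulr0n !(mulr0, addr0).
by subst q'; rewrite (edge_inj_l d_gt1 e e') eqxx in npp'.
Qed.

(** The mixed point [(p.1, q.2)] is neither [p] nor [q], so the state vanishes there. For a product
    this kills [u] at [p.1] or [v] at [q.2], hence the entry at [p] or at [q], which are both
    nonzero. *)
Lemma state_not_product b p q : edge p q -> ~ product_vector (state b p q).
Proof.
move=> e [u [v uv]].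
have uvE r : u r.1 0 * v (mxtens_index r.2) 0 = state b p q (point_index r) 0.
  by rewrite uv tens_colE; case: r => ? [].
have /negbTE npq := edge_neqE e; have [n1 _ n2] := edge_neq d_gt1 e.
have /negbTE nqp : q != p by rewrite eq_sym npq.
have := uvE p; have := uvE q; have := uvE (p.1, q.2).
rewrite !stateE !eqxx npq nqp /=.
have /negbTE -> : p != (p.1, q.2).
  by apply: contraNneq n2 => {1}->.
have /negbTE -> : q != (p.1, q.2).
  by apply: contraNneq n1 => ->.
rewrite !mulr0 !addr0 add0r mulr1 => /eqP; rewrite mulf_eq0 => /orP [] /eqP -> /eqP.
  by rewrite mul0r => _ /eqP; rewrite eq_sym oner_eq0.
by rewrite mulr0 eq_sym signr_eq0.
Qed.

Lemma Sall_OGES : OGES (Sall C d).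
Proof.
split; first exact: Sall_orthogonal.
have np psi : Sall C d psi -> ~ product_vector psi.
  by move=> /SallP [b [p [q [e ->]]]]; apply: state_not_product.
move=> psi S; split.
- move=> psi0; apply: (np _ S); exists 0, 0; rewrite psi0.
  by rewrite tens0mx.
- exact: np.
- exact/np/cyc_Sall.
- exact/np/cyc_Sall/cyc_Sall.
Qed.

Lemma sign_separation (x y : C) :
  (forall b : bool, x + (-1) ^+ b * y = 0) -> x = 0 /\ y = 0.
Proof.
move=> H; have := H false; have := H true.
rewrite expr0 expr1 mulN1r mul1r => /subr0_eq ->.
by rewrite -mulr2n => /eqP; rewrite mulrn_eq0 /= => /eqP ->.
Qed.

(** * Matrix entries of orthogonality-preserving operators *)

Section OrthogonalityPreserving.
Variable M : 'M[C]_(d * (d * d)).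
Hypothesis M_orth : forall phi psi, Sall C d phi -> Sall C d psi -> phi <> psi ->
  braket phi (M *m psi) = 0.

(* The four sign choices separate the four matrix entries. *)
Lemma orthopres_distinct_edges p q p' q' : edge p q -> edge p' q' -> p != p' ->
  [/\ M (point_index p) (point_index p') = 0, M (point_index p) (point_index q') = 0,
      M (point_index q) (point_index p') = 0 & M (point_index q) (point_index q') = 0].
Proof.
move=> e e' ne.
have H b b' : braket (state b p q) (M *m state b' p' q') = 0.
  apply: M_orth; try exact: Sall_state.
  by move=> /(state_inj e e') [_ pp' _]; rewrite pp' eqxx in ne.
have H1 b' := sign_separation (fun b => etrans (esym (braket_state _ _ _ _ _ _ _)) (H b b')).
have [-> ->] := sign_separation (fun b' => proj1 (H1 b')).
by have [-> ->] := sign_separation (fun b' => proj2 (H1 b')).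
Qed.

(** The two states of one edge, taken in both orders, give [(M_pp - M_qq) + s (M_qp - M_pq) = 0] for
    both signs [s]. *)
Lemma orthopres_edge p q : edge p q ->
  M (point_index p) (point_index p) = M (point_index q) (point_index q).
Proof.
move=> e.
have H b : braket (state b p q) (M *m state (~~ b) p q) = 0.
  apply: M_orth; try exact: Sall_state.
  by move=> /(state_inj e e) [+ _ _]; case: b.
set x := M _ _; set y := M _ _.
have [|/subr0_eq //] := @sign_separation (x - y)
  (M (point_index q) (point_index p) - M (point_index p) (point_index q)).
move=> b; rewrite -(H b) braket_state -/x -/y.
by case: b; rewrite /= ?expr0 ?expr1; ring.
Qed.

Lemma boundary_oriented p : p \in boundary d ->
  exists b x y, edge x y /\ p = if b then y else x.
Proof.
by move=> /(boundary_matched d_gt1) [q [e|e]]; [exists false, p, q|exists true, q, p].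
Qed.

(* The paired basis vectors differ in all three tensor factors, so an operator
   acting on one side of A|BC has no entry between them. *)
Hypothesis M_local : forall p q, p.1 != q.1 -> p.2 != q.2 ->
  M (point_index p) (point_index q) = 0.

Lemma orthopres_boundary p q : p \in boundary d -> q \in boundary d -> p != q ->
  M (point_index p) (point_index q) = 0.
Proof.
move=> /boundary_oriented [b [x [y [e ->]]]] /boundary_oriented [b' [x' [y' [e' ->]]]].
have [xx'|nxx'] := eqVneq x x'; last first.
  have [? ? ? ?] := orthopres_distinct_edges e e' nxx'.
  by case: b b' => [] [].
subst x'; have yy' := edge_inj_r d_gt1 e e'; subst y'.
have [n1 _ n2] := edge_neq d_gt1 e.
have n3 : x.2 != y.2 by apply: contraNneq n2 => ->.
by case: b b' => [] []; rewrite ?eqxx // => _; apply: M_local; rewrite // eq_sym.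
Qed.

End OrthogonalityPreserving.

(** * Triviality on both sides of the cut A|BC *)

(* f is constant on antidiagonals i + j = s, and the other two relations link
   s = j with s = j + d and s = j + 1 with s = j + d - 1. Hence j ~ j + 2, and
   1 ~ d - 1 joins the two parity classes because d is odd. *)
Lemma antidiagonals_connected (T : Type) (f : nat -> nat -> T) :
  odd d ->
  (forall i j, i <= d - 2 -> j <= d - 2 -> f i j.+1 = f i.+1 j)%N ->
  (forall j, j <= d - 2 -> f 0 j = f d.-1 j.+1)%N ->
  (forall j, j <= d - 2 -> f j.+1 0 = f j d.-1)%N ->
  forall i j, (i < d)%N -> (j < d)%N -> f i j = f 0%N 0%N.
Proof.
move=> d_odd h1 h2 h3.
(* Antidiagonals with [i + j < d] reach row 0. *)
have low i j : (i + j < d)%N -> f i j = f 0%N (i + j)%N.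
  elim: i j => [|i IH] j hij; first by rewrite add0n.
  rewrite -h1; [|lia|lia]; rewrite IH; last lia.
  by congr f; lia.
(* The others reach row [d - 1] after [k] steps; [k < j] says exactly that [i + j >= d]. *)
have high k i j : (i + k)%N = d.-1 -> (j < d)%N -> (k < j)%N ->
    f i j = f d.-1 (j - k)%N.
  elim: k i j => [|k IH] i j hik hj hkj.
    by rewrite subn0; congr f; lia.
  case: j hj hkj => [//|j] hj hkj.
  rewrite h1; [|lia|lia]; rewrite IH; [|lia..].
  by congr f; lia.
(* The path runs from [(0, j + 2)] through [(j + 2, 0)], [(j + 1, d - 1)] and [(d - 1, j + 1)] to
   [(0, j)]. *)
have step j : (j.+2 < d)%N -> f 0%N j.+2 = f 0%N j.
  move=> hj; rewrite -[in LHS](addn0 j.+2) -low ?addn0 // h3; last lia.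
  rewrite (high (d.-1 - j.+1)%N); [|lia..].
  by rewrite (h2 j); [congr f; lia|lia].
have even m : (m.*2 < d)%N -> f 0%N m.*2 = f 0%N 0%N.
  elim: m => [//|m IH] hm; rewrite doubleS step; last by rewrite -doubleS.
  by apply: IH; lia.
have f1 : f 0%N 1%N = f 0%N 0%N.
  (* Move from [(0, 1)] to [(1, 0)], then by [h3] to [(0, d - 1)], whose second coordinate is
     even. *)
  rewrite -[in LHS](addn0 1%N) -low ?addn0 // h3 //.
  by rewrite (_ : d.-1 = d./2.*2) ?even //; lia.
have oddm m : (m.*2.+1 < d)%N -> f 0%N m.*2.+1 = f 0%N 0%N.
  elim: m => [//|m IH] hm; rewrite doubleS step; last by rewrite -doubleS.
  by apply: IH; lia.
have f0 j : (j < d)%N -> f 0%N j = f 0%N 0%N.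
  move=> hj; rewrite -[j]odd_double_half in hj *; case: (odd j) hj => hj.
    by rewrite add1n oddm.
  by rewrite add0n even.
move=> i j hi hj; have [hij|hij] := ltnP (i + j) d; first by rewrite low ?f0.
(* For [s = i + j >= d] the antidiagonal ends at [(d - 1, s - d + 1)], which [h2] sends to
   [(0, s - d)]. *)
rewrite (high (d.-1 - i)%N); [|lia..].
rewrite (_ : (j - (d.-1 - i))%N = (j - (d.-1 - i)).-1.+1); last lia.
by rewrite -h2 ?f0 //; lia.
Qed.

Let o0 : 'I_d := Ordinal (ltnW d_gt1).
(** Natural-number indices permit induction and the use of [antidiagonals_connected]; out-of-range
    values default to 0. *)
Let o (k : nat) : 'I_d := insubd o0 k.

Lemma val_o k : (k < d)%N -> o k = k :> nat.
Proof. by move=> hk; rewrite val_insubd hk. Qed.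

Lemma o_ord (i : 'I_d) : o i = i.
Proof. by apply: val_inj; rewrite /= val_o. Qed.

Lemma orthopres_left_trivial k (E : 'I_k -> 'M[C]_d) :
  orthopres_left (Sall C d : set 'cV_(d * (d * d))) E -> trivial_povm E.
Proof.
move=> orthoE l; have {}orthoE := orthoE l.
set M := _ *t _ in orthoE.
have ME p q : M (point_index p) (point_index q) = E l p.1 q.1 * (p.2 == q.2)%:R.
  rewrite tensmxE mxE (inj_eq (can_inj (@mxtens_indexK _ _))).
  by case: p q => [? []] ? ? [? []].
have Mloc p q : p.1 != q.1 -> p.2 != q.2 -> M (point_index p) (point_index q) = 0.
  by move=> _ /negbTE n; rewrite ME n mulr0.
have bd i : (i, (o0, o0)) \in boundary d by rewrite !inE /= andbF.
have offdiag i j : i != j -> E l i j = 0.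
  move=> nij; have := orthopres_boundary orthoE Mloc (bd i) (bd j).
  rewrite ME eqxx mulr1; apply.
  by apply: contraNneq nij => -[->].
have diag i : (i < d)%N -> E l (o i) (o i) = E l o0 o0.
  elim: i => [_|i IH hi].
    by rewrite -(o_ord o0).
  (* An edge of [S2] with [j = 0]: its A coordinates are consecutive, so such edges chain all
     diagonal entries. *)
  have e : edge (o i.+1, (o0, o 0%N)) (o i, (o d.-1, o 1%N)).
    by rewrite /edge /facet /= !val_o ?eqxx ?orbT //; lia.
  have := orthopres_edge orthoE e; rewrite !ME !eqxx !mulr1 => ->.
  by apply: IH; lia.
apply/is_scalar_mxP; exists (E l o0 o0); apply/matrixP => i j; rewrite mxE.
have [<-|nij] := eqVneq i j; last by rewrite (offdiag _ _ nij) mulr0n.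
by rewrite -(diag i) // o_ord.
Qed.

Lemma orthopres_right_trivial k (E : 'I_k -> 'M[C]_(d * d)) : odd d ->
  orthopres_right (Sall C d : set 'cV_(d * (d * d))) E -> trivial_povm E.
Proof.
move=> d_odd orthoE l; have {}orthoE := orthoE l.
set M := _ *t _ in orthoE.
pose ix (x : 'I_d * 'I_d) := mxtens_index x.
have ME p q : M (point_index p) (point_index q) = (p.1 == q.1)%:R * E l (ix p.2) (ix q.2).
  by rewrite tensmxE mxE; case: p q => [? []] ? ? [? []].
have Mloc p q : p.1 != q.1 -> p.2 != q.2 -> M (point_index p) (point_index q) = 0.
  by move=> /negbTE n _; rewrite ME n mul0r.
have bd x : (o0, x) \in boundary d by rewrite !inE.
have offdiag x y : x != y -> E l (ix x) (ix y) = 0.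
  move=> nxy; have := orthopres_boundary orthoE Mloc (bd x) (bd y).
  rewrite ME eqxx mul1r; apply.
  by apply: contraNneq nxy => -[->].
have diag p q : edge p q -> E l (ix p.2) (ix p.2) = E l (ix q.2) (ix q.2).
  by move=> /(orthopres_edge orthoE); rewrite !ME !eqxx !mul1r.
pose f i j := E l (ix (o i, o j)) (ix (o i, o j)).
have fE i j : (i < d)%N -> (j < d)%N -> f i j = f 0%N 0%N.
  (* The three relations come from [S1], [S2] and [S3] in turn; in the last two the free A
     coordinate is taken between 0 and 1. *)
  apply: antidiagonals_connected => // {i j}.
  - move=> i j hi hj; apply: (diag (o 0%N, (o i, o j.+1)) (o d.-1, (o i.+1, o j))).
    by rewrite /edge /facet /= !val_o ?eqxx ?orbT //; lia.
  - move=> j hj; apply: (diag (o 1%N, (o 0%N, o j)) (o 0%N, (o d.-1, o j.+1))).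
    by rewrite /edge /facet /= !val_o ?eqxx ?orbT //; lia.
  - move=> j hj; apply: (diag (o 0%N, (o j.+1, o 0%N)) (o 1%N, (o j, o d.-1))).
    by rewrite /edge /facet /= !val_o ?eqxx ?orbT //; lia.
apply/is_scalar_mxP; exists (f 0%N 0%N); apply/matrixP => r s; rewrite mxE.
case: (mxtens_indexP r) => i j; case: (mxtens_indexP s) => i' j'.
rewrite (inj_eq (can_inj (@mxtens_indexK _ _))).
have [<-|nij] := eqVneq (i, j) (i', j'); last by rewrite [LHS]offdiag ?mulr0n.
by rewrite mulr1n -(fE i j) // /f !o_ord.
Qed.

Lemma Sall_strongest_nonlocality : odd d -> strongest_nonlocality (Sall C d).
Proof.
move=> d_odd.
have triv : only_trivial_povms (Sall C d : set 'cV_(d * (d * d))).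
  split=> k E _; first exact: orthopres_left_trivial.
  exact: orthopres_right_trivial.
split; rewrite ?image_comp ?image_cyc_Sall //; first exact: Sall_orthogonal.
by rewrite -image_comp !image_cyc_Sall.
Qed.

(** * Counting the states *)

(* Numbers the states by the boundary points of the cube: the first point of an
   edge labels the sum, the second one the difference. *)
Definition boundary_state p : tri C d :=
  if [pick q | edge p q] is Some q then state false p q
  else if [pick q | edge q p] is Some q then state true q p else 0.

Lemma boundary_stateP p : p \in boundary d -> exists b x y,
  [/\ edge x y, p = (if b then y else x) & boundary_state p = state b x y].
Proof.
move=> /(boundary_matched d_gt1) [q pq]; rewrite /boundary_state.
case: pickP => [x e|n]; first by exists false, p, x.
case: pickP => [x e|n']; first by exists true, x, p.
by case: pq; rewrite ?n ?n'.
Qed.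

Lemma boundary_state_inj : {in boundary d &, injective boundary_state}.
Proof.
move=> p p' /boundary_stateP [b [x [y [e -> ->]]]].
move=> /boundary_stateP [b' [x' [y' [e' -> ->]]]].
by move=> /(state_inj e e') [-> -> ->].
Qed.

(** This gives surjectivity of the numbering: since edges are disjoint, the choice made by [pick]
    can only return the given edge. *)
Lemma boundary_state_edge b p q : edge p q ->
  boundary_state (if b then q else p) = state b p q.
Proof.
move=> e; have [pB qB] := edge_boundary d_gt1 e.
have /boundary_stateP [b' [x [y [e' + ->]]]] : (if b then q else p) \in boundary d.
  by case: b.
case: b b' => [] [] eqp; subst.
- by rewrite (edge_inj_l d_gt1 e e').
- by rewrite (negbTE (edge_oriented d_gt1 _ e)) in e'.
- by rewrite (negbTE (edge_oriented _ _ e')) in e.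
- by rewrite (edge_inj_r d_gt1 e e').
Qed.

Lemma card_Sall : Sall C d #= `I_(d ^ 3 - (d - 2) ^ 3)%N.
Proof.
rewrite -(card_boundary d_gt1); apply: card_eq_trans (card_set_finset _).
rewrite (_ : Sall C d = boundary_state @` [set` boundary d]); last first.
  apply/seteqP; split=> [psi /SallP [b [p [q [e ->]]]]|_ [p pB <-]].
    exists (if b then q else p); last exact: boundary_state_edge.
    by have [] := edge_boundary d_gt1 e; case: b.
  have [b [x [y [e _ ->]]]] := boundary_stateP pB.
  exact: Sall_state.
apply: inj_card_eq => p q; rewrite !inE => pB qB.
exact: boundary_state_inj.
Qed.

End States.

Theorem proposition1 (R : realType) (d : nat) (hd : (3 <= d)%N) (hodd : odd d) :
  [/\ OGES (Sall R[i] d),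
      strongest_nonlocality (Sall R[i] d) &
      Sall R[i] d #= `I_(d ^ 3 - (d - 2) ^ 3)%N].
Proof.
have d_gt1 : (1 < d)%N by apply: leq_trans hd.
split; first exact: Sall_OGES.
- exact: Sall_strongest_nonlocality.
- exact: card_Sall.
Qed.
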